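(* Let $n\ge 3$ and let $F_n^2$ be the complex $n$-dimensional Leibniz algebra with basis $\{x_1,\dots,x_n\}$ and multiplication $[x_i,x_1]=x_{i+1}$ for $1\le i\le n-2$ (all other products of basis elements are zero). Then every infinitesimal deformation $\varphi\in ZL^2(F_n^2,F_n^2)$ has the following form, for some complex numbers $\alpha_{j,k}$, $\beta_2,\dots,\beta_n$, $\gamma_1$, $\gamma_n$: $$\begin{cases}\varphi(x_j,x_1)=\sum_{k=1}^{n}\alpha_{j,k}x_k, & 1\le j\le n-2,\\ \varphi(x_{n-1},x_1)=\sum_{k=2}^{n}\alpha_{n-1,k}x_k,\\ \varphi(x_n,x_1)=\sum_{k=1}^{n}\alpha_{n,k}x_k,\\ \varphi(x_i,x_{j+1})=-\alpha_{j,1}x_{i+1}, & 1\le i\le n-2,\ 1\le j\le n-2,\\ \varphi(x_1,x_n)=-\alpha_{n,1}x_1+\sum_{k=2}^{n}\beta_kx_k,\\ \varphi(x_i,x_n)=-i\alpha_{n,1}x_i+\sum_{k=2}^{n-i}\beta_kx_{k+i-1}, & 2\le i\le n-1,\\ \varphi(x_n,x_n)=\gamma_1x_{n-1}+\gamma_nx_n,\end{cases}$$ where all values $\varphi(x_p,x_q)$ not listed are zero.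
   Context: A Leibniz algebra over $\mathbb{C}$ is a vector space $L$ with a bilinear bracket satisfying $[x,[y,z]]=[[x,y],z]-[[x,z],y]$ for all $x,y,z$. An infinitesimal deformation ($2$-cocycle) of $L$ is a bilinear map $\varphi:L\times L\to L$ with $$[x,\varphi(y,z)]-[\varphi(x,y),z]+[\varphi(x,z),y]+\varphi(x,[y,z])-\varphi([x,y],z)+\varphi([x,z],y)=0$$ for all $x,y,z\in L$; the space of all of them is denoted $ZL^2(L,L)$. *)

(* Defs.v *)
From HB Require Import structures.
From mathcomp Require Import all_boot all_order all_algebra.
From mathcomp Require Export sesquilinear reals complex.

Set Implicit Arguments.
Unset Strict Implicit.
Unset Printing Implicit Defensive.

Import GRing.Theory.
Local Open Scope ring_scope.

Definition leibniz_identity (V : zmodType) (br : V -> V -> V) : Prop :=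
  forall x y z, br x (br y z) = br (br x y) z - br (br x z) y.

HB.mixin Record isLeibniz (K : fieldType) L of GRing.Lmodule K L := {
  lbr : L -> L -> L;
  lbr_bilinear : bilinear_for *:%R *:%R lbr;
  lbr_leibniz : leibniz_identity lbr
}.

#[short(type="leibnizAlgType")]
HB.structure Definition Leibniz (K : fieldType) :=
  {L of GRing.Lmodule K L & isLeibniz K L}.

Definition ZL2 (K : fieldType) (L : leibnizAlgType K)
    (phi : {bilinear L -> L -> L}) : Prop :=
  forall x y z : L,
    lbr x (phi y z) - lbr (phi x y) z + lbr (phi x z) y
    + phi x (lbr y z) - phi (lbr x y) z + phi (lbr x z) y = 0.

Definition F2 (K : fieldType) (n : nat) : Type := 'rV[K]_n.

#[warning="-redundant-canonical-projection"]
HB.instance Definition _ (K : fieldType) n := GRing.Lmodule.on (F2 K n).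

(* The basis is numbered from 1: for 1 <= i <= n, F2x K n i is the i-th
   standard basis vector; it is 0 for the other values of i. *)
Definition F2x (K : fieldType) (n i : nat) : F2 K n :=
  \row_(k < n) (k.+1 == i)%:R.

Definition F2_table (K : fieldType) (n i j : nat) : F2 K n :=
  if (1 <= i <= n - 2)%N && (j == 1%N) then F2x K n i.+1 else 0.

(* The bilinear extension of the multiplication table; the ordinals i, j
   stand for the 1-based indices i.+1, j.+1. *)
Definition F2_bracket (K : fieldType) (n : nat) (u v : F2 K n) : F2 K n :=
  \sum_(i < n) \sum_(j < n)
    ((u : 'rV_n) 0 i * (v : 'rV_n) 0 j) *: F2_table K n i.+1 j.+1.

Section F2Leibniz.
Variables (K : fieldType) (n : nat).
Implicit Types u v w : F2 K n.

Lemma F2x_delta (i : 'I_n) : F2x K n i.+1 = delta_mx 0 i.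
Proof. by apply/rowP => k; rewrite !mxE. Qed.

Lemma F2_bracket_bilinear : bilinear_for *:%R *:%R (@F2_bracket K n).
Proof.
split=> u a v w /=; rewrite /F2_bracket scaler_sumr -big_split /=;
  apply: eq_bigr => i _; rewrite scaler_sumr -big_split /=;
  apply: eq_bigr => j _; rewrite scalerA -scalerDl !mxE.
  by rewrite mulrDl mulrA.
by rewrite mulrDr mulrCA.
Qed.

Lemma F2_bracketx (i j : nat) : (1 <= i <= n)%N -> (1 <= j <= n)%N ->
  F2_bracket (F2x K n i) (F2x K n j) = F2_table K n i j.
Proof.
case: i => // i; case: j => // j /= ltin ltjn.
rewrite /F2_bracket (bigD1 (Ordinal ltin)) //= (bigD1 (Ordinal ltjn)) //=.
rewrite !mxE !eqxx mulr1 scale1r !big1 ?addr0 // => k.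
  move=> neki; rewrite big1 // => l _.
  have /negPf nei : val k != i by rewrite -(inj_eq val_inj) in neki.
  by rewrite !mxE eqSS nei mul0r scale0r.
move=> nekj.
have /negPf nej : val k != j by rewrite -(inj_eq val_inj) in nekj.
by rewrite !mxE !eqSS nej mulr0 scale0r.
Qed.

Lemma F2_bracket_leibniz : leibniz_identity (@F2_bracket K n).
Proof.
case: n => [|m] u v w; first by apply/rowP => -[].
pose S (x : F2 K m.+1) : F2 K m.+1 := \sum_(i < m.+1)
  ((x : 'rV_m.+1) 0 i) *: F2_table K m.+1 i.+1 1.
have brE (x y : F2 K m.+1) : F2_bracket x y = ((y : 'rV_m.+1) 0 0) *: S x.
  rewrite /F2_bracket /S scaler_sumr; apply: eq_bigr => i _.
  rewrite (bigD1 ord0) //= big1 ?addr0; first by rewrite scalerA mulrC.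
  move=> j; rewrite -(inj_eq val_inj) => /negPf /= nej0.
  by rewrite /F2_table eqSS nej0 andbF scaler0.
have S0 (x : F2 K m.+1) : (S x : 'rV_m.+1) 0 0 = 0.
  rewrite summxE big1 // => i _; rewrite mxE /F2_table eqxx andbT.
  by case: ifP => _; rewrite mxE ?mulr0 //= eqSS mulr0.
have SZ (a : K) (x : F2 K m.+1) : S (a *: x) = a *: S x.
  by rewrite /S scaler_sumr; apply: eq_bigr => i _; rewrite mxE scalerA.
rewrite (brE u) (brE v w) mxE S0 mulr0 scale0r.
by rewrite !brE !SZ !scalerA mulrC subrr.
Qed.

HB.instance Definition _ :=
  isLeibniz.Build K (F2 K n) F2_bracket_bilinear F2_bracket_leibniz.

Lemma F2_lbrx (i j : nat) : (1 <= i <= n)%N -> (1 <= j <= n)%N ->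
  lbr (F2x K n i) (F2x K n j) = F2_table K n i j.
Proof. exact: F2_bracketx. Qed.

End F2Leibniz.

(* The pairs (p, q) for which the normal form prescribes phi(x_p, x_q),
   one line for each displayed equation. *)
Definition F2_listed (n p q : nat) : bool :=
  [|| (1 <= p <= n - 2) && (q == 1),
      (p == n - 1) && (q == 1),
      (p == n) && (q == 1),
      (1 <= p <= n - 2) && (1 <= q - 1 <= n - 2),
      (p == 1) && (q == n),
      (2 <= p <= n - 1) && (q == n)
    | (p == n) && (q == n)]%N.

(* Main.v *)
Require Import Defs.
From HB Require Import structures.
From mathcomp Require Import all_boot all_order all_algebra.
From mathcomp Require Import zify.

Import GRing.Theory.
Local Open Scope ring_scope.
Local Open Scope complex_scope.

(** The bracket of [F_n^2] is [[u, v] = v_1 * S u], where [v_1] is the first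
    coordinate of [v] and [S = [-, x_1]] is the nilpotent shift
    [x_1 -> x_2 -> ... -> x_(n-1) -> 0], which also kills [x_n].  Hence the
    second argument of every bracket in the cocycle condition enters only through
    its first coordinate.  Write [phi_1] for the first coordinate of [phi] and let [z] be
    a vector of first coordinate [0].  Taking [x_1] and [z] as second and third
    arguments gives three relations, valid for all [x]:

    - at [(x_1, x_1)]: [phi(x, x_2) = - phi_1(x_1, x_1) * S x] ([cocycle_x2]);
    - at [(x_1, z)]: [phi(S x, z) = S phi(x, z) + phi_1(x_1, z) * S x]
      ([cocycle_shiftl]);
    - at [(z, x_1)], combined with the previous one:
      [phi(x, S z) = - (phi_1(z, x_1) + phi_1(x_1, z)) * S x]
      ([cocycle_shiftr]).

    The first and third relations determine [phi(x, x_q)] for [2 <= q < n],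
    because every such [x_q] is a shift of [x_(q-1)].  These values are multiples
    of [S x], so their first coordinate is [0], and the third relation reduces to
    [phi(x, x_(j+1)) = - phi_1(x_j, x_1) * S x] ([cocycle_middle]).  As
    [S x_(n-1) = S x_n = 0], the same relation at [z = x_(n-1)] and [z = x_n]
    gives [phi_1(x_(n-1), x_1) = 0] and [phi_1(x_1, x_n) = - phi_1(x_n, x_1)].
    The second relation at [z = x_n] is a recursion along the chain which yields
    all [phi(x_i, x_n)] with [i < n] from [phi(x_1, x_n)] ([cocycle_xn_chain]),
    and at [x = x_n] it says [S phi(x_n, x_n) = 0], so that [phi(x_n, x_n)] lies
    in the span of [x_(n-1)] and [x_n]. *)

HB.instance Definition _ (K : fieldType) (L : leibnizAlgType K) :=
  bilinear_isBilinear.Build K L L L *:%R *:%R (@lbr K L) lbr_bilinear.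

(** * Coordinates in the standard basis *)

(** Indexing by natural numbers from 1 matches [F2x], and the value [0] at [k = 0]
    lets [F2_coord_shift] cover the first coordinate as well. *)
Definition F2_coord (K : fieldType) (n k : nat) (v : F2 K n) : K :=
  \sum_(i < n | i.+1 == k) (v : 'rV_n) 0 i.

Lemma F2_coord_linear (K : fieldType) (n k : nat) :
  linear_for *%R (@F2_coord K n k).
Proof.
move=> a u v; rewrite /F2_coord mulr_sumr -big_split /=.
by apply: eq_bigr => i _; rewrite !mxE.
Qed.

HB.instance Definition _ (K : fieldType) (n k : nat) :=
  GRing.isLinear.Build K (F2 K n) K *%R (@F2_coord K n k)
    (F2_coord_linear K n k).

Lemma F2_coordE (K : fieldType) (n : nat) (v : F2 K n) (i : 'I_n) :
  F2_coord K n i.+1 v = (v : 'rV_n) 0 i.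
Proof. by rewrite /F2_coord (big_pred1 i). Qed.

Lemma F2_coord0 (K : fieldType) (n : nat) (v : F2 K n) : F2_coord K n 0 v = 0.
Proof. by rewrite /F2_coord big_pred0. Qed.

Lemma F2_coord_basis (K : fieldType) (n i k : nat) :
  (1 <= i <= n)%N -> F2_coord K n k (F2x K n i) = (k == i)%:R.
Proof.
case: i => // i lt_in; rewrite /F2_coord.
rewrite big_mkcond (bigD1 (Ordinal lt_in)) //= big1 ?addr0 => [|j /negPf nji].
  by rewrite mxE eqxx eq_sym; case: eqP.
by rewrite -(inj_eq val_inj) /= in nji; rewrite mxE eqSS nji; case: eqP.
Qed.

Lemma F2_expand (K : fieldType) (n : nat) (v : F2 K n) :
  v = \sum_(1 <= k < n.+1) F2_coord K n k v *: F2x K n k.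
Proof.
rewrite big_add1 /= big_mkord; apply/rowP => j.
rewrite summxE (bigD1 j) //= big1 => [|k /negPf nkj].
  by rewrite addr0 mxE F2_coordE !mxE eqxx mulr1.
by rewrite !mxE eqSS eq_sym -(inj_eq val_inj) /= in nkj *; rewrite nkj mulr0.
Qed.

(** * The bracket as a shift *)

Definition F2_shift (K : fieldType) (n : nat) (u : F2 K n) : F2 K n :=
  lbr u (F2x K n 1).

Lemma F2_shift_linear (K : fieldType) (n : nat) : linear (@F2_shift K n).
Proof. by move=> a u v; rewrite /F2_shift linearPl. Qed.

HB.instance Definition _ (K : fieldType) (n : nat) :=
  GRing.isLinear.Build K (F2 K n) (F2 K n) *:%R (@F2_shift K n)
    (F2_shift_linear K n).

Lemma F2_lbrE (K : fieldType) (n : nat) (u v : F2 K n) :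
  lbr u v = F2_coord K n 1 v *: F2_shift K n u.
Proof.
case: n u v => [|m] u v; first by apply/rowP => -[].
rewrite [in LHS](F2_expand _ _ v) linear_sumr big_ltn //= linearZr_LR.
rewrite big_nat big1 ?addr0 // => k /andP[k_gt1 k_ltn].
rewrite linearZr_LR (F2_expand _ _ u) linear_sumlz.
rewrite big_nat big1 => [|i i_n]; first by rewrite /= scaler0.
rewrite linearZl_LR /= F2_lbrx; [|lia..].
by rewrite /F2_table (gtn_eqF k_gt1) andbF /= scaler0.
Qed.

Lemma F2_shift_basis (K : fieldType) (n i : nat) : (1 <= i <= n)%N ->
  F2_shift K n (F2x K n i) = if (i.+1 < n)%N then F2x K n i.+1 else 0.
Proof.
move=> i_n; rewrite /F2_shift F2_lbrx; [|lia..].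
by rewrite /F2_table eqxx andbT; congr (if _ then _ else _); lia.
Qed.

(** The case [k = 0] says that shifts have no first coordinate. *)
Lemma F2_coord_shift (K : fieldType) (n k : nat) (u : F2 K n) :
  (k.+1 < n)%N -> F2_coord K n k.+1 (F2_shift K n u) = F2_coord K n k u.
Proof.
move=> lt_k1n; rewrite (F2_expand _ _ u) (linear_sum (F2_shift K n)).
rewrite !(linear_sum (F2_coord K n _)) /=.
apply: eq_big_nat => i i_n; rewrite (linearZ_LR (F2_shift K n)).
rewrite !linearZ /= F2_shift_basis; last by lia.
congr (_ * _); case: ifP => [lt_i1n|ge_i1n].
  by rewrite !F2_coord_basis ?eqSS //; lia.
by rewrite linear0 F2_coord_basis; [case: eqP => //; lia | lia].
Qed.

(** A positive number of shifts leaves the part of [x_1, ..., x_n] that stays in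
    the chain ending at [x_(n-1)]; for [j = 0] the formula would fail at
    [k = n]. *)
Lemma F2_iter_shift_basis (K : fieldType) (n j k : nat) :
  (0 < j)%N -> (1 <= k <= n)%N ->
  iter j (F2_shift K n) (F2x K n k) =
    if (k + j < n)%N then F2x K n (k + j) else 0.
Proof.
case: j => // j _ k_n; elim: j => [|j IHj]; first by rewrite addn1 /= F2_shift_basis.
rewrite iterS IHj; case: ifP => [lt_n|ge_n].
  by rewrite F2_shift_basis ?addnS //; lia.
by rewrite linear0; case: ifP => //; lia.
Qed.

Lemma F2_iter_shift_sum (K : fieldType) (n j : nat) (b : nat -> K) :
  (0 < j)%N ->
  iter j (F2_shift K n) (\sum_(2 <= k < n.+1) b k *: F2x K n k) =
    \sum_(2 <= k < n - j) b k *: F2x K n (k + j).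
Proof.
move=> j_gt0.
have -> (r : seq nat) (F : nat -> F2 K n) :
    iter j (F2_shift K n) (\sum_(k <- r) b k *: F k) =
    \sum_(k <- r) b k *: iter j (F2_shift K n) (F k).
  elim: (j) F => //= i IHi F; rewrite IHi linear_sum.
  by apply: eq_bigr => k _; rewrite linearZ.
rewrite [RHS](big_nat_widen _ _ n.+1); last by lia.
rewrite [RHS]big_mkcond /=; apply: eq_big_nat => k k_n.
rewrite F2_iter_shift_basis //; last by lia.
have -> : (k + j < n)%N = (k < n - j)%N by lia.
by case: ifP; rewrite ?scaler0.
Qed.

(** * The cocycle condition case by case *)

Section Cocycle.

Variables (K : fieldType) (n : nat).
Hypothesis n_ge3 : (3 <= n)%N.
Variable phi : {bilinear F2 K n -> F2 K n -> F2 K n}.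
Hypothesis phi_cocycle : ZL2 phi.

Local Notation x := (F2x K n).
Local Notation S := (F2_shift K n).
Local Notation c := (F2_coord K n).

Lemma cocycle_shift (u v w : F2 K n) :
  c 1%N (phi v w) *: S u - c 1%N w *: S (phi u v) + c 1%N v *: S (phi u w)
  + c 1%N w *: phi u (S v) - c 1%N v *: phi (S u) w
  + c 1%N w *: phi (S u) v = 0.
Proof.
have := phi_cocycle u v w; rewrite !F2_lbrE.
by rewrite !linearZr_LR !linearZl_LR.
Qed.

Let coord_x1 : c 1%N (x 1) = 1.
Proof. by rewrite F2_coord_basis //; lia. Qed.

Lemma F2_shift_x1 : S (x 1) = x 2.
Proof. by rewrite F2_shift_basis ?ifT //; lia. Qed.

Lemma F2x_neq0 (i : nat) : (1 <= i <= n)%N -> x i != 0.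
Proof.
move=> i_n; apply/eqP => /(congr1 (c i)) /eqP.
by rewrite F2_coord_basis // eqxx linear0 oner_eq0.
Qed.

Lemma cocycle_x2 (u : F2 K n) :
  phi u (x 2) = - c 1%N (phi (x 1) (x 1)) *: S u.
Proof.
have := cocycle_shift u (x 1) (x 1).
rewrite coord_x1 !scale1r !subrK F2_shift_x1 => /eqP.
by rewrite addrC addr_eq0 scaleNr => /eqP.
Qed.

Lemma cocycle_shiftl (u w : F2 K n) : c 1%N w = 0 ->
  phi (S u) w = S (phi u w) + c 1%N (phi (x 1) w) *: S u.
Proof.
move=> w0; have := cocycle_shift u (x 1) w.
rewrite coord_x1 w0 !scale0r !scale1r !addr0 subr0 => /eqP.
by rewrite subr_eq0 addrC => /eqP.
Qed.

Lemma cocycle_shiftr (u w : F2 K n) : c 1%N w = 0 ->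
  phi u (S w) = - (c 1%N (phi w (x 1)) + c 1%N (phi (x 1) w)) *: S u.
Proof.
move=> w0; have := cocycle_shift u w (x 1).
rewrite coord_x1 w0 !scale0r !scale1r addr0 subr0 cocycle_shiftl // => /eqP.
by rewrite addrAC subrKA -scalerDl addrC addr_eq0 scaleNr => /eqP.
Qed.

Let coord_x (i : nat) : (2 <= i <= n)%N -> c 1%N (x i) = 0.
Proof. by move=> i_n; rewrite F2_coord_basis; [case: i i_n => [|[|i]] | lia]. Qed.

Let coord_shift1 (u : F2 K n) : c 1%N (S u) = 0.
Proof. by rewrite F2_coord_shift ?F2_coord0 //; lia. Qed.

Let x_shift (j : nat) : (1 <= j <= n - 2)%N -> x (j + 1) = S (x j).
Proof. by move=> j_n; rewrite F2_shift_basis ?ifT ?addn1 //; lia. Qed.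

(** [cocycle_x2] for [j = 2] and [cocycle_shiftr] for [j > 2] express
    [phi(x_1, x_j)] as a multiple of a shift. *)
Lemma cocycle_x1_middle (j : nat) :
  (2 <= j <= n - 1)%N -> c 1%N (phi (x 1) (x j)) = 0.
Proof.
case: j => [|[|[|j]]] // j_n.
  by rewrite cocycle_x2 linearZ /= coord_shift1 mulr0.
rewrite -[j.+3]addn1 x_shift; last by lia.
rewrite cocycle_shiftr; last by rewrite coord_x //; lia.
by rewrite linearZ /= coord_shift1 mulr0.
Qed.

Lemma cocycle_middle (u : F2 K n) (j : nat) : (1 <= j <= n - 2)%N ->
  phi u (x (j + 1)) = - c 1%N (phi (x j) (x 1)) *: S u.
Proof.
case: j => [|[|j]] // j_n; first exact: cocycle_x2.
rewrite x_shift // cocycle_shiftr; last by rewrite coord_x //; lia.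
by rewrite cocycle_x1_middle ?addr0 //; lia.
Qed.

(** The left-hand side of [cocycle_shiftr] at [u = x_1] vanishes, and the scalar
    on its right-hand side can be read off because [S x_1 = x_2] is nonzero. *)
Lemma cocycle_shift_kernel (w : F2 K n) : c 1%N w = 0 -> S w = 0 ->
  c 1%N (phi (x 1) w) = - c 1%N (phi w (x 1)).
Proof.
move=> w0 Sw0; have := cocycle_shiftr (x 1) w w0.
rewrite Sw0 linear0r F2_shift_x1 => /esym /eqP.
rewrite scaler_eq0 (negPf (F2x_neq0 2 _)) ?orbF; last by lia.
by rewrite oppr_eq0 addrC addr_eq0 => /eqP.
Qed.

Let shift_top (i : nat) : (n - 1 <= i <= n)%N -> S (x i) = 0.
Proof. by move=> i_n; rewrite F2_shift_basis ?ifF //; lia. Qed.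

Lemma cocycle_xpred_x1 : c 1%N (phi (x (n - 1)) (x 1)) = 0.
Proof.
apply: oppr_inj; rewrite -cocycle_shift_kernel.
- by rewrite cocycle_x1_middle ?oppr0 //; lia.
- by rewrite coord_x //; lia.
- by rewrite shift_top //; lia.
Qed.

Lemma cocycle_x1_xn : c 1%N (phi (x 1) (x n)) = - c 1%N (phi (x n) (x 1)).
Proof.
by rewrite cocycle_shift_kernel ?coord_x ?shift_top //; lia.
Qed.

Lemma cocycle_x1_xn_expand :
  phi (x 1) (x n) = - c 1%N (phi (x n) (x 1)) *: x 1
    + \sum_(2 <= k < n.+1) c k (phi (x 1) (x n)) *: x k.
Proof.
rewrite -cocycle_x1_xn [LHS](F2_expand _ _ (phi _ _)) big_ltn //; lia.
Qed.

(** Each step of the recursion along the chain shifts the previous value and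
    contributes one more multiple of the new basis vector, which explains the
    factor [j + 1]; the other part of [phi(x_1, x_n)] is merely shifted. *)
Lemma cocycle_xn_chain (j : nat) : (j <= n - 2)%N ->
  phi (x j.+1) (x n) =
    - (j.+1%:R * c 1%N (phi (x n) (x 1))) *: x j.+1
    + iter j S (\sum_(2 <= k < n.+1) c k (phi (x 1) (x n)) *: x k).
Proof.
elim: j => [|j IHj] j_n; first by rewrite mul1r -cocycle_x1_xn_expand.
rewrite -[in LHS](addn1 j.+1) x_shift; last by lia.
rewrite cocycle_shiftl; last by rewrite coord_x //; lia.
rewrite IHj; last by lia.
rewrite linearD linearZ /= -x_shift; last by lia.
rewrite cocycle_x1_xn addn1 addrAC -scalerDl -opprD.
by rewrite -[in RHS](natr1 j.+1) mulrDl mul1r.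
Qed.

Lemma cocycle_xn_middle (i : nat) : (2 <= i <= n - 1)%N ->
  phi (x i) (x n) = - (i%:R * c 1%N (phi (x n) (x 1))) *: x i
    + \sum_(2 <= k < (n - i).+1) c k (phi (x 1) (x n)) *: x (k + i - 1)%N.
Proof.
case: i => [|[|i]] // i_n; rewrite cocycle_xn_chain; last by lia.
rewrite F2_iter_shift_sum //; congr (_ + _).
have -> : (n - i.+1 = (n - i.+2).+1)%N by lia.
by apply: eq_bigr => k _; congr (_ *: F2x K n _); lia.
Qed.

Lemma cocycle_xn_xn :
  phi (x n) (x n) =
    c (n - 1)%N (phi (x n) (x n)) *: x (n - 1) + c n (phi (x n) (x n)) *: x n.
Proof.
set v := phi (x n) (x n).
have Sv0 : S v = 0.
  have := cocycle_shiftl (x n) (x n); rewrite shift_top; last by lia.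
  by rewrite linear0l scaler0 addr0 => <- //; rewrite coord_x //; lia.
have cv0 k : (k < n - 1)%N -> c k v = 0.
  by move=> k_n; rewrite -F2_coord_shift ?Sv0 ?linear0 //; lia.
rewrite [LHS](F2_expand _ _ v) big_nat_recr /=; last by lia.
rewrite (big_cat_nat (n := (n - 1)%N)) /=; [|lia..].
rewrite big_nat big1 => [|k k_n]; last by rewrite cv0 ?scale0r //; lia.
by rewrite add0r big_ltn ?big_geq ?addr0 //; lia.
Qed.

End Cocycle.

(** * The normal form *)

Theorem proposition3p11 (R : realType) (n : nat) (n_ge3 : (3 <= n)%N)
    (phi : {bilinear F2 R[i] n -> F2 R[i] n -> F2 R[i] n})
    (phi_cocycle : ZL2 phi) :
  let x := F2x R[i] n in
  exists (alpha : nat -> nat -> R[i]) (beta : nat -> R[i])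
         (gamma1 gamman : R[i]),
    (forall j : nat, (1 <= j <= n - 2)%N ->
       phi (x j) (x 1%N) = \sum_(1 <= k < n.+1) alpha j k *: x k) /\
    phi (x (n - 1)%N) (x 1%N) =
      \sum_(2 <= k < n.+1) alpha (n - 1)%N k *: x k /\
    phi (x n) (x 1%N) = \sum_(1 <= k < n.+1) alpha n k *: x k /\
    (forall i j : nat, (1 <= i <= n - 2)%N -> (1 <= j <= n - 2)%N ->
       phi (x i) (x (j + 1)%N) = - alpha j 1%N *: x (i + 1)%N) /\
    phi (x 1%N) (x n) =
      - alpha n 1%N *: x 1%N + \sum_(2 <= k < n.+1) beta k *: x k /\
    (forall i : nat, (2 <= i <= n - 1)%N ->
       phi (x i) (x n) =
         - (i%:R * alpha n 1%N) *: x i +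
         \sum_(2 <= k < (n - i).+1) beta k *: x (k + i - 1)%N) /\
    phi (x n) (x n) = gamma1 *: x (n - 1)%N + gamman *: x n /\
    (forall p q : nat, (1 <= p <= n)%N -> (1 <= q <= n)%N ->
       ~~ F2_listed n p q -> phi (x p) (x q) = 0).

Proof.
move=> x.
pose c := F2_coord R[i] n.
exists (fun j k => c k (phi (x j) (x 1%N))), (fun k => c k (phi (x 1%N) (x n))).
exists (c (n - 1)%N (phi (x n) (x n))), (c n (phi (x n) (x n))).
split=> [j _|]; first exact: F2_expand.
split.
  rewrite [LHS](F2_expand _ _ (phi _ _)) big_ltn; last by lia.
  by rewrite cocycle_xpred_x1 // scale0r add0r.
split; first exact: F2_expand.
split=> [i j i_n j_n|].
  rewrite cocycle_middle // F2_shift_basis ?ifT ?addn1 //; lia.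
split; first exact: cocycle_x1_xn_expand.
split=> [i i_n|]; first exact: cocycle_xn_middle.
split=> [|p q p_n q_n]; first exact: cocycle_xn_xn.
rewrite /F2_listed => unlisted.
have [p_top q_mid] : (n - 1 <= p <= n)%N /\ (2 <= q <= n - 1)%N by lia.
have -> : q = (q.-1 + 1)%N by lia.
rewrite cocycle_middle //; last by lia.
rewrite F2_shift_basis ?ifF ?scaler0 //; lia.
Qed.
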